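(* Let $(M,g)$ be a Riemannian manifold of dimension $n\ge2$ and let $G$ be a natural metric on $TM$. If $(TM,G)$ is flat, then $(M,g)$ is flat.
   Context: All objects are $C^\infty$. $\pi:TM\to M$ is the tangent bundle, $K:TTM\to TM$ the connection map of the Levi-Civita connection $\nabla$ of $g$ (the velocity at $0$ of a curve $Y(s)$ in $TM$ is sent to its covariant derivative $\frac{\nabla Y}{ds}(0)$). For $q\in M$, $u=(u_1,\dots,u_n)$ an orthonormal basis of $M_q$, $\xi\in\mathbb{R}^n$ and $v=\sum_i\xi^iu_i$, let $e_i(q,u,\xi),e_{n+i}(q,u,\xi)\in(TM)_v$ ($1\le i\le n$) be the vectors with $\pi_*(e_i)=u_i$, $K(e_i)=0$, $\pi_*(e_{n+i})=0$, $K(e_{n+i})=u_i$. A natural metric on $TM$ is a Riemannian metric $G$ such that $\pi:(TM,G)\to(M,g)$ is a Riemannian submersion, the horizontal spaces $\ker K_v$ and vertical spaces $\ker\pi_{*v}$ are $G$-orthogonal, and the matrix of $G$ in the basis $e_1(q,u,\xi),\dots,e_{2n}(q,u,\xi)$ depends only on $\xi$. Equivalently, there are differentiable functions $\alpha,\beta:[0,+\infty)\to\mathbb{R}$ with $\alpha(t)>0$ and $\alpha(t)+t\beta(t)>0$ for all $t\ge0$ such that at $(q,u,\xi)$: $G(e_i,e_j)=\delta_{ij}$, $G(e_i,e_{n+j})=0$, $G(e_{n+i},e_{n+j})=\alpha(|\xi|^2)\delta_{ij}+\beta(|\xi|^2)\xi^i\xi^j$ for $1\le i,j\le n$. Flat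 means that the curvature tensor vanishes identically. *)

(* Defs.v *)
(* Smooth manifolds given by an atlas, over MathComp-Analysis' 'R : realType'. *)
From mathcomp Require Import all_boot all_order all_algebra.
From mathcomp Require Import all_classical all_reals all_analysis.
From mathcomp Require Import ring lra.

Set Implicit Arguments.
Unset Strict Implicit.
Unset Printing Implicit Defensive.

Import Order.TTheory GRing.Theory Num.Theory.
Import numFieldNormedType.Exports.

Local Open Scope classical_set_scope.
Local Open Scope ring_scope.

(* C^k and C^oo maps on an open set U; every derivative is required at the
   points of U only. *)
Fixpoint Ck (R : realType) (V W : normedModType R) (k : nat) (U : set V)
    (f : V -> W) : Prop :=
  match k with
  | 0 => forall x, U x -> {for x, continuous f}
  | k'.+1 => (forall x, U x -> differentiable f x) /\
             forall v : V, Ck k' U ('D_v f)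
  end.

Definition smooth_on (R : realType) (V W : normedModType R) (U : set V)
    (f : V -> W) : Prop := forall k, Ck k U f.

(* A set with n-dimensional charts. [cpar a] is the inverse of the chart
   [cmap a] on its image and is unconstrained elsewhere; [chart_at p] is a chosen
   chart around p. The axioms are in [smooth_manifold]. *)
Record charted_space (R : realType) (n : nat) := ChartedSpace {
  pt :> Type;
  idx : Type;
  cdom : idx -> set pt;
  cmap : idx -> pt -> 'rV[R]_n;
  cpar : idx -> 'rV[R]_n -> pt;
  chart_at : pt -> idx }.

Section Manifold.
Variables (R : realType) (n : nat) (M : charted_space R n).
Implicit Types (a b : idx M) (p q : M).

Definition transition a b : 'rV[R]_n -> 'rV[R]_n := cmap b \o cpar a.

Definition smooth_atlas : Prop :=
  [/\ forall p, cdom (chart_at p) p,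
      forall a p, cdom a p -> cpar a (cmap a p) = p,
      forall a b, open (cmap a @` (cdom a `&` cdom b)) &
      forall a b, smooth_on (cmap a @` (cdom a `&` cdom b)) (transition a b)].

Definition atlas_open (U : set M) : Prop :=
  forall a, open (cmap a @` (cdom a `&` U)).

Definition atlas_hausdorff : Prop :=
  forall p q, p <> q -> exists U V : set M,
    [/\ atlas_open U, atlas_open V, U p, V q & U `&` V = set0].

Definition atlas_second_countable : Prop :=
  exists B : nat -> set M, (forall k, atlas_open (B k)) /\
    forall (U : set M) p, atlas_open U -> U p ->
      exists k, B k p /\ B k `<=` U.

Definition smooth_manifold : Prop :=
  [/\ smooth_atlas, atlas_hausdorff & atlas_second_countable].

(* A tangent vector at p is given by its components in the chart [chart_at p], so
   that the tangent space at p is 'rV[R]_n. [tcoord a p w] are the components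
   in the chart a of the tangent vector w at p; [tvec a x y] is the tangent
   vector at [cpar a x] whose components in the chart a are y. *)
Definition tcoord a p (w : 'rV[R]_n) : 'rV[R]_n :=
  'D_w (transition (chart_at p) a) (cmap (chart_at p) p).

Definition tvec a (x y : 'rV[R]_n) : 'rV[R]_n :=
  'D_y (transition a (chart_at (cpar a x))) x.

End Manifold.

Definition smooth_map (R : realType) (m n : nat) (X : charted_space R m)
    (Y : charted_space R n) (f : X -> Y) : Prop :=
  forall (a : idx X) (b : idx Y),
    open (cmap a @` (cdom a `&` f @^-1` cdom b)) /\
    smooth_on (cmap a @` (cdom a `&` f @^-1` cdom b)) (cmap b \o f \o cpar a).

Definition pushforward (R : realType) (m n : nat) (X : charted_space R m)
    (Y : charted_space R n) (f : X -> Y) (p : X) (w : 'rV[R]_m) : 'rV[R]_n :=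
  'D_w (cmap (chart_at (f p)) \o f \o cpar (chart_at p)) (cmap (chart_at p) p).

(* The tangent bundle, with the charts (x, y) induced by the charts of M. *)
Definition TM (R : realType) (n : nat) (M : charted_space R n) :
    charted_space R (n + n) :=
  @ChartedSpace R (n + n) (M * 'rV[R]_n)%type (idx M)
    (fun a v => cdom a v.1)
    (fun a v => row_mx (cmap a v.1) (tcoord a v.1 v.2))
    (fun a z => (cpar a (lsubmx z), tvec a (lsubmx z) (rsubmx z)))
    (fun v => chart_at v.1).

Definition tproj (R : realType) (n : nat) (M : charted_space R n) (v : TM M) :
  M := v.1.

Section Riemannian.
Variables (R : realType) (n : nat).

Definition bform (A : 'M[R]_n) (u w : 'rV[R]_n) : R := (u *m A *m w^T) 0 0.

Definition partial (i : 'I_n) (F : 'rV[R]_n -> R) : 'rV[R]_n -> R :=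
  'D_(delta_mx 0 i) F.

(* The coefficient Gamma^k_ij of the Levi-Civita connection of the metric h on
   an open subset of R^n; see [christoffelP]. *)
Definition christoffel (h : 'rV[R]_n -> 'M[R]_n) (x : 'rV[R]_n)
    (k i j : 'I_n) : R :=
  2^-1 * \sum_l invmx (h x) k l *
    (partial i (fun y => h y j l) x + partial j (fun y => h y i l) x
     - partial l (fun y => h y i j) x).

Definition levi_civita_at (h : 'rV[R]_n -> 'M[R]_n) (x : 'rV[R]_n)
    (Gam : 'I_n -> 'I_n -> 'I_n -> R) : Prop :=
  (forall k i j, Gam k i j = Gam k j i) /\
  (forall k i j, partial k (fun y => h y i j) x =
     \sum_l (Gam l k i * h x l j + Gam l k j * h x i l)).

(* The component dx^l (R(d_i, d_j) d_k) of the curvature tensor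
   R(X, Y) Z = nabla_X nabla_Y Z - nabla_Y nabla_X Z - nabla_[X, Y] Z. *)
Definition curvature_coef (Gam : 'rV[R]_n -> 'I_n -> 'I_n -> 'I_n -> R)
    (x : 'rV[R]_n) (l k i j : 'I_n) : R :=
  partial i (fun y => Gam y l j k) x - partial j (fun y => Gam y l i k) x
  + \sum_m (Gam x l i m * Gam x m j k - Gam x l j m * Gam x m i k).

Variable M : charted_space R n.

(* A field of bilinear forms on M is given at p by its matrix with respect to
   the chart [chart_at p]; [metric_in_chart g a] is its matrix in the chart a. *)
Definition metric_in_chart (g : M -> 'M[R]_n) (a : idx M) (x : 'rV[R]_n) :
    'M[R]_n :=
  \matrix_(i, j) bform (g (cpar a x)) (tvec a x (delta_mx 0 i))
                                      (tvec a x (delta_mx 0 j)).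

Definition riemannian_metric (g : M -> 'M[R]_n) : Prop :=
  [/\ forall p, (g p)^T = g p,
      forall p w, w != 0 -> 0 < bform (g p) w w &
      forall a i j,
        smooth_on (cmap a @` cdom a) (fun x => metric_in_chart g a x i j)].

Definition curvature (g : M -> 'M[R]_n) (p : M) (X Y Z : 'rV[R]_n) :
    'rV[R]_n :=
  \row_l \sum_i \sum_j \sum_k X 0 i * Y 0 j * Z 0 k *
    curvature_coef (christoffel (metric_in_chart g (chart_at p))) (cmap (chart_at p) p)
      l k i j.

Definition flat (g : M -> 'M[R]_n) : Prop :=
  forall p X Y Z, curvature g p X Y Z = 0.

(* The bilinear map (u, w) |-> (Gamma^k_ij u^i w^j)_k at p, in the chart
   [chart_at p]. *)
Definition Gamma (g : M -> 'M[R]_n) (p : M) (u w : 'rV[R]_n) : 'rV[R]_n :=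
  \row_k \sum_i \sum_j
    christoffel (metric_in_chart g (chart_at p)) (cmap (chart_at p) p) k i j
    * u 0 i * w 0 j.

Definition velocity (Y : R -> M) (s : R) : 'rV[R]_n :=
  derive1 (cmap (chart_at (Y s)) \o Y) s.

End Riemannian.

Definition riemannian_submersion (R : realType) (m n : nat)
    (X : charted_space R m) (Y : charted_space R n) (G : X -> 'M[R]_m)
    (g : Y -> 'M[R]_n) (f : X -> Y) : Prop :=
  [/\ smooth_map f,
      forall q, exists p, f p = q,
      forall p w, exists z, pushforward f p z = w &
      forall p z z',
        (forall k, pushforward f p k = 0 ->
           bform (G p) z k = 0 /\ bform (G p) z' k = 0) ->
        bform (G p) z z' =
        bform (g (f p)) (pushforward f p z) (pushforward f p z')].

Section TangentBundle.
Variables (R : realType) (n : nat) (M : charted_space R n).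

(* nabla Y / ds at s, for a curve Y in TM. *)
Definition covariant_derivative (g : M -> 'M[R]_n) (Y : R -> TM M) (s : R) :
    'rV[R]_n :=
  derive1 (fun t => tcoord (chart_at (Y s).1) (Y t).1 (Y t).2) s
  + Gamma g (Y s).1 (velocity (@tproj R n M \o Y) s) (Y s).2.

(* K : T_v TM -> T_(tproj v) M in the induced chart; [connection_map_velocity]
   is its characterization by curves. *)
Definition connection_map (g : M -> 'M[R]_n) (v : TM M) (z : 'rV[R]_(n + n)) :
    'rV[R]_n :=
  rsubmx z + Gamma g v.1 (lsubmx z) v.2.

(* The rows of u are an orthonormal basis u_1, ..., u_n of the tangent space
   at q. *)
Definition orthonormal_basis (g : M -> 'M[R]_n) (q : M) (u : 'M[R]_n) : Prop :=
  forall i j, bform (g q) (row i u) (row j u) = (i == j)%:R.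

(* The rows of e are e_1(q,u,xi), ..., e_2n(q,u,xi), tangent to TM at
   xi *m u = \sum_i xi^i u_i. *)
Definition adapted_frame (g : M -> 'M[R]_n) (q : M) (u : 'M[R]_n)
    (xi : 'rV[R]_n) (e : 'M[R]_(n + n)) : Prop :=
  let v : TM M := (q, xi *m u) in
  forall i : 'I_n,
    [/\ pushforward (@tproj R n M) v (row (lshift n i) e) = row i u,
        connection_map g v (row (lshift n i) e) = 0,
        pushforward (@tproj R n M) v (row (rshift n i) e) = 0 &
        connection_map g v (row (rshift n i) e) = row i u].

Definition natural_metric (g : M -> 'M[R]_n) (G : TM M -> 'M[R]_(n + n)) :
    Prop :=
  [/\ riemannian_metric G,
      riemannian_submersion G g (@tproj R n M),
      forall v h k, connection_map g v h = 0 ->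
        pushforward (@tproj R n M) v k = 0 -> bform (G v) h k = 0 &
      exists A : 'rV[R]_n -> 'M[R]_(n + n), forall q u xi e,
        orthonormal_basis g q u -> adapted_frame g q u xi e ->
        forall i j, bform (G (q, xi *m u)) (row i e) (row j e) = A xi i j].

End TangentBundle.

Section Facts.
Variables (R : realType) (n : nat).

Lemma christoffelP (h : 'rV[R]_n -> 'M[R]_n) x Gam :
  (forall y, (h y)^T = h y) -> h x \in unitmx ->
  levi_civita_at h x Gam <-> Gam = christoffel h x.
Proof.
move=> hT hU; have hE y i j : h y i j = h y j i by rewrite -[in LHS]hT mxE.
have dE k i j : partial k (fun y => h y i j) x = partial k (fun y => h y j i) x.
  by congr (partial k _ x); apply/funext => y; apply: hE.
have low i j l : \sum_k christoffel h x k i j * h x k l =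
    2^-1 * (partial i (fun y => h y j l) x + partial j (fun y => h y i l) x
     - partial l (fun y => h y i j) x).
  pose w : 'rV[R]_n := \row_l
    (partial i (fun y => h y j l) x + partial j (fun y => h y i l) x
     - partial l (fun y => h y i j) x).
  have iT : (invmx (h x))^T = invmx (h x) by rewrite trmx_inv hT.
  have -> : \sum_k christoffel h x k i j * h x k l =
      2^-1 * (w *m invmx (h x) *m h x) 0 l.
    rewrite mxE mulr_sumr; apply: eq_bigr => k _.
    rewrite /christoffel !mxE -mulrA; congr (_ * (_ * _)).
    by apply: eq_bigr => m _; rewrite -[in LHS]iT !mxE mulrC.
  by rewrite mulmxKV // mxE.
split=> [[Gsym Gmet]|->]; last first.
  split=> [k i j|k i j].
    rewrite /christoffel; congr (_ * _); apply: eq_bigr => l _.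
    by rewrite (addrC (partial i _ x)) (dE l i j).
  rewrite big_split /= low.
  rewrite (_ : \sum_i0 _ = \sum_l christoffel h x l k j * h x l i); last first.
    by apply: eq_bigr => l _; rewrite (hE x i l).
  rewrite low -mulrDr (dE k j i) (dE i k j) (dE j k i) (dE i j k) (dE j i k).
  set p := partial k _ x; set q := partial i _ x; set r := partial j _ x.
  by lra.
have low' i j l : \sum_k Gam k i j * h x k l =
    \sum_k christoffel h x k i j * h x k l.
  rewrite low !Gmet !big_split /=.
  pose S a b c := \sum_k Gam k a b * h x k c.
  have S1 a b c : \sum_k Gam k a b * h x c k = S a b c.
    by apply: eq_bigr => k _; rewrite (hE x c k).
  have S2 a b c : S a b c = S b a c.
    by apply: eq_bigr => k _; rewrite Gsym.
  rewrite !S1 -!/(S _ _ _) (S2 j i l) (S2 l i j) (S2 l j i).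
  set p := S i j l; set q := S i l j; set r := S j l i.
  by lra.
apply/funext => k; apply/funext => i; apply/funext => j.
pose a : 'rV[R]_n := \row_k Gam k i j.
pose b : 'rV[R]_n := \row_k christoffel h x k i j.
suff ab : a = b by move/rowP/(_ k): ab; rewrite !mxE.
apply: (can_inj (mulmxK hU)); apply/rowP => l; rewrite !mxE.
under eq_bigr do rewrite mxE; under [RHS]eq_bigr do rewrite mxE.
exact: low'.
Qed.

Variable M : charted_space R n.

Lemma tcoord_cat (p : M) w : smooth_atlas M -> tcoord (chart_at p) p w = w.
Proof.
case=> catP parK op _; rewrite /tcoord.
set c := chart_at p; rewrite -[RHS](@derive_id R _ (cmap c p)).
apply: near_eq_derive; near=> y.
have [q [cq _] <-] : (cmap c @` (cdom c `&` cdom c)) y.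
  near: y; apply: open_nbhs_nbhs; split; first exact: op.
  by exists p => //; split; apply: catP.
by rewrite /transition /= parK.
Unshelve. all: by end_near. Qed.

Lemma connection_map_velocity (g : M -> 'M[R]_n) (Y : R -> TM M) (s : R) :
  derivable (cmap (chart_at (Y s)) \o Y) s 1 ->
  connection_map g (Y s) (velocity Y s) = covariant_derivative g Y s.
Proof.
move=> /derivable1_diffP dY; set Z := _ \o Y in dY.
have lsubE : velocity (@tproj R n M \o Y) s = lsubmx (velocity Y s).
  have dl := differentiable_lsubmx (Z s).
  rewrite /velocity !derive1E -/Z (deriveE _ dY).
  have -> : cmap (chart_at ((@tproj R n M \o Y) s)) \o (@tproj R n M \o Y) =
      lsubmx \o Z by apply/funext => t; rewrite /= row_mxKl.
  rewrite (deriveE _ (differentiable_comp dY dl)).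
  rewrite (diff_comp dY dl) /= diff_lin //; exact: continuous_lsubmx.
have rsubE : derive1 (fun t => tcoord (chart_at (Y s).1) (Y t).1 (Y t).2) s =
    rsubmx (velocity Y s).
  have dr := differentiable_rsubmx (Z s).
  rewrite /velocity !derive1E -/Z (deriveE _ dY).
  have -> : (fun t => tcoord (chart_at (Y s).1) (Y t).1 (Y t).2) =
      rsubmx \o Z by apply/funext => t; rewrite /= row_mxKr.
  rewrite (deriveE _ (differentiable_comp dY dr)).
  rewrite (diff_comp dY dr) /= diff_lin //; exact: continuous_rsubmx.
by rewrite /covariant_derivative lsubE rsubE.
Qed.

End Facts.

(* Main.v *)
(* Along the zero section the horizontal lifts of coordinate vectors are tangent
   to it, so there G splits as the orthogonal sum of g and a vertical metric.
   At height t y the connection map of the lift of a coordinate vector is linear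
   in t, hence the horizontal block of G differs from g by O(t^2) and its
   vertical derivatives vanish on the zero section. The zero section is thus an
   isometric copy of (M, g) that is totally geodesic in (TM, G), and the
   curvature of g is the restriction of that of G. *)
Require Import Defs.
From mathcomp Require Import all_boot all_order all_algebra.
From mathcomp Require Import all_classical all_reals all_analysis.

Set Implicit Arguments.
Unset Strict Implicit.
Unset Printing Implicit Defensive.

Import Order.TTheory GRing.Theory Num.Theory.
Import numFieldNormedType.Exports.

Local Open Scope classical_set_scope.
Local Open Scope ring_scope.

(** * Limits of block rows and directional derivatives *)

Lemma cvg_row_mx (R : realType) (T : Type) (F : set_system T)
    {FF : Filter F} (m n1 n2 : nat) (f : T -> 'M[R]_(m, n1))
    (g : T -> 'M[R]_(m, n2)) (a : 'M[R]_(m, n1)) (b : 'M[R]_(m, n2)) :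
  f @ F --> a -> g @ F --> b ->
  (fun t => row_mx (f t) (g t)) @ F --> row_mx a b.
Proof.
move=> /cvgrPdist_le fa /cvgrPdist_le gb.
apply/cvgrPdist_le => e e0; near=> t.
rewrite opp_row_mx add_row_mx [leLHS]/Num.Def.normr/= mx_normrE.
rewrite (bigmax_le _ (ltW e0))//= => -[i j] _; rewrite [in leLHS]mxE.
case: splitP => k _.
  apply: (@le_trans _ _ `|a - f t|); last by near: t; exact: fa.
  rewrite [leRHS]/Num.Def.normr/= mx_normrE.
  exact: (le_bigmax _ (fun k => `|(a - f t) k.1 k.2|) (i, k)).
apply: (@le_trans _ _ `|b - g t|); last by near: t; exact: gb.
rewrite [leRHS]/Num.Def.normr/= mx_normrE.
exact: (le_bigmax _ (fun k => `|(b - g t) k.1 k.2|) (i, k)).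
Unshelve. all: by end_near. Qed.

Lemma cvg_line0 (R : realType) (V : normedModType R) (x u : V) :
  h *: u + x @[h --> (0 : R)] --> x.
Proof.
rewrite -[X in _ --> X]add0r -[X in _ --> X + _](scale0r u).
by apply: cvgD; [apply: cvgZr_tmp; exact: cvg_id|exact: cvg_cst].
Qed.

Lemma derive_comp (R : realType) (U V W : normedModType R) (f : U -> V)
    (g : V -> W) x y : differentiable f x -> differentiable g (f x) ->
  'D_y (g \o f) x = 'D_('D_y f x) g (f x).
Proof.
move=> df dg; rewrite (deriveE _ dg) (deriveE _ df).
by rewrite (deriveE _ (differentiable_comp df dg)) (diff_comp df dg).
Qed.

(** * Transition maps of [M] and the transition maps they induce on [TM M] *)

Section Transition.
Variables (R : realType) (n : nat) (M : charted_space R n).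
Hypothesis atlasM : smooth_atlas M.
Implicit Types (a b c : idx M) (p q : M) (u w y : 'rV[R]_n).

Lemma cparK a p : cdom a p -> cpar a (cmap a p) = p.
Proof. by case: atlasM => _ + _ _; apply. Qed.

Lemma chart_atP p : cdom (chart_at p) p.
Proof. by case: atlasM => + _ _ _; apply. Qed.

Lemma near_chart2 a b p : cdom a p -> cdom b p ->
  \forall x \near cmap a p, (cmap a @` (cdom a `&` cdom b)) x.
Proof.
move=> ap bp; apply: open_nbhs_nbhs; split; last by exists p.
by case: atlasM => _ _ + _; apply.
Qed.

Lemma differentiable_transition a b p : cdom a p -> cdom b p ->
  differentiable (transition a b) (cmap a p).
Proof.
by move=> ap bp; case: atlasM => _ _ _ /(_ a b 1%N)[+ _]; apply; exists p.
Qed.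

Lemma differentiable_derive_transition a b p y : cdom a p -> cdom b p ->
  differentiable ('D_y (transition a b)) (cmap a p).
Proof.
move=> ap bp; case: atlasM => _ _ _ /(_ a b 2%N)[_ /(_ y)[+ _]]; apply.
by exists p.
Qed.

Lemma derive_transition_linear a b p (k : R) y w : cdom a p -> cdom b p ->
  'D_(k *: y + w) (transition a b) (cmap a p) =
  k *: 'D_y (transition a b) (cmap a p) + 'D_w (transition a b) (cmap a p).
Proof.
move=> ap bp.
by rewrite !deriveE ?linearP //; exact: differentiable_transition.
Qed.

(** The cocycle identity for transition maps holds on the image of the overlap of [a] and [b], a
    neighbourhood of [cmap a p]; the chain rule differentiates it. *)
Lemma derive_transition_comp a b c p y : cdom a p -> cdom b p -> cdom c p ->
  'D_('D_y (transition a b) (cmap a p)) (transition b c) (cmap b p) =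
  'D_y (transition a c) (cmap a p).
Proof.
move=> ap bp cp.
have dab := differentiable_transition ap bp.
have tabE : transition a b (cmap a p) = cmap b p.
  by rewrite /transition /= cparK.
have dbc : differentiable (transition b c) (transition a b (cmap a p)).
  by rewrite tabE; exact: differentiable_transition.
rewrite -[cmap b p]tabE -(derive_comp y dab dbc).
apply: near_eq_derive; near=> x.
have [q [aq bq] <-] : (cmap a @` (cdom a `&` cdom b)) x.
  by near: x; exact: near_chart2.
by rewrite /transition /= !cparK.
Unshelve. all: by end_near. Qed.

Lemma derive_transition_id a p y : cdom a p ->
  'D_y (transition a a) (cmap a p) = y.
Proof.
move=> ap; rewrite -[RHS](@derive_id R _ (cmap a p)).
apply: near_eq_derive; near=> x.
have [q [aq _] <-] : (cmap a @` (cdom a `&` cdom a)) x.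
  by near: x; exact: near_chart2.
by rewrite /transition /= cparK.
Unshelve. all: by end_near. Qed.

Lemma derive_transition_eq0 a b p y : cdom a p -> cdom b p ->
  'D_y (transition a b) (cmap a p) = 0 -> y = 0.
Proof.
move=> ap bp y0.
by rewrite -(derive_transition_id y ap) -(derive_transition_comp y ap bp ap) y0
  derive0.
Qed.

Lemma tvecE a p y : cdom a p ->
  tvec a (cmap a p) y = 'D_y (transition a (chart_at p)) (cmap a p).
Proof. by move=> ap; rewrite /tvec (cparK ap). Qed.

Lemma tcoord_tvec a b p y : cdom a p -> cdom b p ->
  tcoord b p (tvec a (cmap a p) y) = 'D_y (transition a b) (cmap a p).
Proof.
move=> ap bp; rewrite (tvecE y ap).
exact: derive_transition_comp ap (chart_atP p) bp.
Qed.

Lemma transition_TM a b p y : cdom a p -> cdom b p ->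
  @transition R (n + n) (TM M) a b (row_mx (cmap a p) y) =
  row_mx (transition a b (cmap a p)) ('D_y (transition a b) (cmap a p)).
Proof.
move=> ap bp.
rewrite {1}/transition /= row_mxKl row_mxKr (cparK ap) (tcoord_tvec y ap bp).
by rewrite {2}/transition /= (cparK ap).
Qed.

(** With phi the transition from [a] to [b], the induced map is (x, y) |-> (phi x, D_y phi x). Its
    difference quotient is treated directly: by linearity of D_y phi in y, the second component
    splits into the quotient of D_y phi along u and the term D_w phi (x + h u), which converges by
    continuity. *)
Lemma derive_transition_TM a b p u w y : cdom a p -> cdom b p ->
  'D_(row_mx u w) (@transition R (n + n) (TM M) a b) (row_mx (cmap a p) y) =
  row_mx ('D_u (transition a b) (cmap a p))
    ('D_u ('D_y (transition a b)) (cmap a p) +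
     'D_w (transition a b) (cmap a p)).
Proof.
move=> ap bp; set phi := transition a b; set x := cmap a p.
have dphi : derivable phi x u.
  by apply: diff_derivable; exact: differentiable_transition.
have dDphi : derivable ('D_y phi) x u.
  by apply: diff_derivable; exact: differentiable_derive_transition.
have line0 : h *: u + x @[h --> (0 : R)^'] --> x.
  apply: cvg_trans (@cvg_line0 R _ x u).
  by apply: cvg_app; exact: cvg_within.
have cw : 'D_w phi (h *: u + x) @[h --> (0 : R)^'] --> 'D_w phi x.
  apply: cvg_comp line0 (_ : {for x, continuous ('D_w phi)}).
  apply: differentiable_continuous.
  exact: differentiable_derive_transition.
have L : row_mx (h^-1 *: ((phi \o shift x) (h *: u) - phi x))
     (h^-1 *: (('D_y phi \o shift x) (h *: u) - 'D_y phi x) +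
      'D_w phi (h *: u + x)) @[h --> (0 : R)^'] -->
    row_mx ('D_u phi x) ('D_u ('D_y phi) x + 'D_w phi x).
  exact: (cvg_row_mx dphi (cvgD dDphi cw)).
apply: cvg_lim; first exact: norm_hausdorff.
apply: cvg_trans L; apply: near_eq_cvg; near=> h.
have [q [aq bq] xq] : (cmap a @` (cdom a `&` cdom b)) (h *: u + x).
  near: h; exact: (line0 _ (near_chart2 ap bp)).
have h0 : h != 0 by near: h; exact: nbhs_dnbhs_neq.
rewrite /comp /shift scale_row_mx add_row_mx -xq.
rewrite (transition_TM _ aq bq) (transition_TM _ ap bp).
rewrite (derive_transition_linear h w y aq bq) -/phi -/x.
rewrite opp_row_mx add_row_mx scale_row_mx; congr row_mx.
rewrite -addrA [in RHS]scalerDr scalerA (mulVf h0) scale1r. exact: addrC.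
Unshelve. all: by end_near. Qed.

End Transition.

(** * Bilinear forms and Gram matrices *)

Section BilinearForm.
Variables (R : realType) (n : nat).
Implicit Types (A : 'M[R]_n) (u w : 'rV[R]_n).

Lemma bformDl A u u' w : bform A (u + u') w = bform A u w + bform A u' w.
Proof. by rewrite /bform !mulmxDl mxE. Qed.

Lemma bformDr A u w w' : bform A u (w + w') = bform A u w + bform A u w'.
Proof. by rewrite /bform linearD mulmxDr mxE. Qed.

Lemma bformZl A k u w : bform A (k *: u) w = k * bform A u w.
Proof. by rewrite /bform -!scalemxAl mxE. Qed.

Lemma bformZr A k u w : bform A u (k *: w) = k * bform A u w.
Proof. by rewrite /bform linearZ -scalemxAr mxE. Qed.

Lemma bform0l A w : bform A 0 w = 0.
Proof. by rewrite /bform !mul0mx mxE. Qed.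

Lemma bform0r A u : bform A u 0 = 0.
Proof. by rewrite /bform trmx0 mulmx0 mxE. Qed.

Lemma bformC A u w : A^T = A -> bform A u w = bform A w u.
Proof.
move=> AT; rewrite /bform -[in LHS]AT -[RHS](mxE trmx_key (fun i j => _ j i)).
by rewrite -/(trmx _) !trmx_mul trmxK mulmxA.
Qed.

Lemma bform_delta A i j : bform A (delta_mx 0 i) (delta_mx 0 j) = A i j.
Proof. by rewrite /bform -rowE trmx_delta -colE !mxE. Qed.

Lemma bform_sum A u w : bform A u w = \sum_j \sum_i u 0 i * A i j * w 0 j.
Proof.
rewrite /bform mxE; apply: eq_bigr => j _.
by rewrite !mxE mulr_suml.
Qed.

End BilinearForm.

(** The matrix is [J *m P *m J^T]. A row v in its left kernel has P(vJ, vJ) = 0, so positivity gives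
    vJ = 0 and injectivity gives v = 0. This serves both diagonal blocks of [G] on the zero
    section. *)
Lemma gram_unitmx (R : realType) (n m : nat) (P : 'M[R]_n) (J : 'M[R]_(m, n)) :
  (forall w, w != 0 -> 0 < bform P w w) ->
  (forall v : 'rV_m, v *m J = 0 -> v = 0) ->
  \matrix_(i, j) bform P (delta_mx 0 i *m J) (delta_mx 0 j *m J) \in unitmx.
Proof.
move=> Ppos Jinj.
have -> : \matrix_(i, j) bform P (delta_mx 0 i *m J) (delta_mx 0 j *m J) =
    J *m P *m J^T.
  apply/matrixP => i j; rewrite mxE -[RHS]bform_delta /bform.
  by rewrite trmx_mul !mulmxA.
rewrite -row_free_unit; apply: inj_row_free => v; rewrite !mulmxA => vJ0.
apply: Jinj; apply/eqP/negP => /negP /Ppos.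
by rewrite /bform trmx_mul mulmxA vJ0 mul0mx mxE ltxx.
Qed.

(** * Derivatives along and across the zero section, and curvature components *)

Lemma partial_lshift (R : realType) (n : nat) (F : 'rV[R]_(n + n) -> R) i x :
  partial (lshift n i) F (row_mx x 0) = partial i (fun x => F (row_mx x 0)) x.
Proof.
rewrite /partial /derive.
set f := (fun h : R => _); set f' := (fun h : R => _).
(* The line through (x, 0) in a direction of the first block stays in the slice y = 0, so the two
   difference quotients coincide. *)
suff -> : f = f' by [].
apply/funext => t; rewrite /f /f'.
by rewrite /= delta_mx_lshift scale_row_mx add_row_mx scaler0 addr0.
Qed.

Lemma sum_delta3 (R : realType) (n : nat) (i0 j0 k0 : 'I_n)
    (C : 'I_n -> 'I_n -> 'I_n -> R) :
  \sum_i \sum_j \sum_k (delta_mx 0 i0 : 'rV[R]_n) 0 i *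
    (delta_mx 0 j0 : 'rV[R]_n) 0 j * (delta_mx 0 k0 : 'rV[R]_n) 0 k * C i j k =
  C i0 j0 k0.
Proof.
rewrite (bigD1 i0) //= [X in _ + X]big1 ?addr0 => [|i ii0]; last first.
  apply: big1 => j _; apply: big1 => k _.
  by rewrite mxE (negPf ii0) andbF !mul0r.
rewrite (bigD1 j0) //= [X in _ + X]big1 ?addr0 => [|j jj0]; last first.
  apply: big1 => k _; rewrite [X in _ * X * _ * _]mxE.
  by rewrite (negPf jj0) andbF mulr0 !mul0r.
rewrite (bigD1 k0) //= [X in _ + X]big1 ?addr0 => [|k kk0]; last first.
  by rewrite [X in _ * X * _]mxE (negPf kk0) andbF mulr0 mul0r.
by rewrite !mxE !eqxx !mul1r.
Qed.

Lemma curvature_delta (R : realType) (n : nat) (M : charted_space R n)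
    (g : M -> 'M[R]_n) p i j k l :
  curvature g p (delta_mx 0 i) (delta_mx 0 j) (delta_mx 0 k) 0 l =
  curvature_coef (christoffel (metric_in_chart g (chart_at p)))
    (cmap (chart_at p) p) l k i j.
Proof.
rewrite mxE.
exact: (sum_delta3 i j k (fun i j k => curvature_coef _ _ l k i j)).
Qed.

Lemma bform_row0Z (R : realType) (m n : nat) (P : 'M[R]_(m + n))
    (t : R) (u w : 'rV[R]_n) :
  bform P (row_mx 0 (t *: u)) (row_mx 0 (t *: w)) =
  t * (t * bform P (row_mx 0 u) (row_mx 0 w)).
Proof.
have scale0 (v : 'rV[R]_n) :
    row_mx (0 : 'rV[R]_m) (t *: v) = t *: row_mx 0 v.
  by rewrite scale_row_mx scaler0.
by rewrite !scale0 bformZl bformZr.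
Qed.

(** The difference quotient is t * r t, which tends to 0 * l. Only the limit of [r] at 0 enters, and
    continuity of [G] along a fibre will provide it. *)
Lemma derive_quadratic (R : realType) (V : normedModType R) (f : V -> R)
    (x v : V) (c : R) (r : R -> R) (l : R) :
  (forall t, f (t *: v + x) = c + t * (t * r t)) ->
  r t @[t --> (0 : R)] --> l -> 'D_v f x = 0.
Proof.
move=> fE rl; apply: cvg_lim; first exact: norm_hausdorff.
have fx : f x = c by have := fE 0; rewrite scale0r add0r !mul0r addr0.
have tr0 : t * r t @[t --> (0 : R)] --> 0 * l by exact: cvgM cvg_id rl.
have {}tr0 : t * r t @[t --> (0 : R)^'] --> (0 : R).
  rewrite -[X in _ --> X](mul0r l); apply: cvg_trans tr0.
  by apply: cvg_app; exact: cvg_within.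
apply: cvg_trans tr0; apply: near_eq_cvg; near=> t.
have t0 : t != 0 by near: t; exact: nbhs_dnbhs_neq.
rewrite /= fE fx addrAC subrr add0r.
by rewrite /GRing.scale /= mulKf.
Unshelve. all: by end_near. Qed.

(** * Tangent vectors of [TM M] in the induced charts *)

Section TangentTransition.
Variables (R : realType) (n : nat) (M : charted_space R n).
Hypothesis atlasM : smooth_atlas M.
Implicit Types (a b c : idx M) (p q : M) (u w y : 'rV[R]_n).

(** The second derivative is the inhomogeneous term of the change of charts on [TM M]; it vanishes
    when y = 0 and when [a] is the preferred chart at p. *)
Lemma tvec_TM a p y u w : cdom a p ->
  @tvec R (n + n) (TM M) a (row_mx (cmap a p) y) (row_mx u w) =
  row_mx (tvec a (cmap a p) u)
    ('D_u ('D_y (transition a (chart_at p))) (cmap a p) + tvec a (cmap a p) w).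
Proof.
move=> ap; rewrite {1}/tvec /= row_mxKl (cparK atlasM ap).
rewrite (derive_transition_TM atlasM u w y ap (chart_atP atlasM p)).
by rewrite !(tvecE atlasM _ ap).
Qed.

Lemma derive2_transition_id a p u y : cdom a p ->
  'D_u ('D_y (transition a a)) (cmap a p) = 0.
Proof.
move=> ap; rewrite -(@derive_cst R _ _ y (cmap a p) u).
apply: near_eq_derive; near=> x.
have [q [aq _] <-] : (cmap a @` (cdom a `&` cdom a)) x.
  by near: x; exact: near_chart2.
exact: derive_transition_id.
Unshelve. all: by end_near. Qed.

Lemma derive2_transitionZ a b p (t : R) u y : cdom a p -> cdom b p ->
  'D_u ('D_(t *: y) (transition a b)) (cmap a p) =
  t *: 'D_u ('D_y (transition a b)) (cmap a p).
Proof.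
move=> ap bp; rewrite -deriveZ; last first.
  by apply: diff_derivable; exact: differentiable_derive_transition.
apply: near_eq_derive; near=> x.
have [q [aq bq] <-] : (cmap a @` (cdom a `&` cdom b)) x.
  by near: x; exact: near_chart2.
have := derive_transition_linear atlasM t y 0 aq bq.
by rewrite addr0 derive0 addr0.
Unshelve. all: by end_near. Qed.

Lemma tvec_jacobian a p u : cdom a p ->
  tvec a (cmap a p) u =
  u *m jacobian (transition a (chart_at p)) (cmap a p).
Proof.
move=> ap; rewrite (tvecE atlasM _ ap); apply: deriveEjacobian.
by apply: differentiable_transition => //; exact: chart_atP.
Qed.

Lemma tvec_eq0 a p u : cdom a p -> tvec a (cmap a p) u = 0 -> u = 0.
Proof.
move=> ap; rewrite (tvecE atlasM _ ap).
exact: derive_transition_eq0 (chart_atP atlasM p).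
Qed.

(** In the preferred chart the projection reads (x, y) |-> x near the coordinates of v, because
    [cmap c] inverts [cpar c] on the open image of the chart. *)
Lemma pushforward_tproj (v : TM M) (z : 'rV[R]_(n + n)) :
  Defs.pushforward (@tproj R n M) v z = lsubmx z.
Proof.
case: v => p y; rewrite /Defs.pushforward /=.
set c := chart_at p; set x := cmap c p.
transitivity ('D_z (lsubmx : 'rV[R]_(n + n) -> 'rV[R]_n)
   (row_mx x (tcoord c p y))).
  apply: near_eq_derive; near=> z'.
  have [q [cq _] xq] : (cmap c @` (cdom c `&` cdom c)) (lsubmx z').
    near: z'; apply: (@continuous_lsubmx R 1 n n (row_mx x (tcoord c p y))).
    by rewrite row_mxKl; apply: near_chart2 => //; exact: chart_atP.
  by rewrite /= -xq (cparK atlasM cq).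
rewrite deriveE; last exact: differentiable_lsubmx.
by rewrite diff_lin //; exact: continuous_lsubmx.
Unshelve. all: by end_near. Qed.

End TangentTransition.

Lemma GammaZr (R : realType) (n : nat) (M : charted_space R n)
    (g : M -> 'M[R]_n) p u (t : R) w :
  Gamma g p u (t *: w) = t *: Gamma g p u w.
Proof.
apply/rowP => k; rewrite !mxE mulr_sumr; apply: eq_bigr => i _.
by rewrite mulr_sumr; apply: eq_bigr => j _; rewrite mxE mulrCA.
Qed.

Lemma Gamma0r (R : realType) (n : nat) (M : charted_space R n)
    (g : M -> 'M[R]_n) p u : Gamma g p u 0 = 0.
Proof. by rewrite -[in LHS](scale0r (0 : 'rV[R]_n)) GammaZr scale0r. Qed.

(** * The metric [G] in induced charts, through its horizontal and vertical parts *)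

Section NaturalMetric.
Variables (R : realType) (n : nat) (M : charted_space R n).
Variables (g : M -> 'M[R]_n) (G : TM M -> 'M[R]_(n + n)).
Hypothesis atlasM : smooth_atlas M.
Hypothesis metg : riemannian_metric g.
Hypothesis metG : riemannian_metric G.
Hypothesis subG : riemannian_submersion G g (@tproj R n M).
Hypothesis horG : forall v h k, connection_map g v h = 0 ->
  Defs.pushforward (@tproj R n M) v k = 0 -> bform (G v) h k = 0.
Implicit Types (a b c : idx M) (p q : M) (u w y : 'rV[R]_n).

Local Notation vert k := (row_mx (0 : 'rV[R]_n) k).

(** Each vector is a horizontal one plus the vertical one with the same image under the connection
    map. Cross terms vanish by [horG]; on horizontal vectors the submersion condition replaces [G]
    by [g]. *)
Lemma metric_split (v : TM M) (X X' : 'rV[R]_(n + n)) :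
  bform (G v) X X' = bform (g v.1) (lsubmx X) (lsubmx X') +
    bform (G v) (vert (connection_map g v X)) (vert (connection_map g v X')).
Proof.
pose hor (Z : 'rV[R]_(n + n)) := Z - vert (connection_map g v Z).
have hor_lift Z : connection_map g v (hor Z) = 0.
  rewrite /hor -[X in X - _]hsubmxK opp_row_mx add_row_mx oppr0 addr0.
  by rewrite /connection_map row_mxKl row_mxKr opprD addrA subrr sub0r addNr.
have lhor Z : lsubmx (hor Z) = lsubmx Z.
  by rewrite /hor linearB /= row_mxKl subr0.
have pvert k : Defs.pushforward (@tproj R n M) v (vert k) = 0.
  by rewrite pushforward_tproj // row_mxKl.
have [GT _ _] := metG.
have horvert Z k : bform (G v) (hor Z) (vert k) = 0.
  by apply: horG; [exact: hor_lift|exact: pvert].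
have horK Z : Z = hor Z + vert (connection_map g v Z) by rewrite subrK.
clearbody hor; rewrite [in LHS](horK X) [in LHS](horK X') bformDl !bformDr.
rewrite horvert addr0 [X in _ + (X + _)]bformC // horvert add0r.
congr (_ + _); have [_ _ _ ->] := subG.
  by rewrite !pushforward_tproj // !lhor.
by move=> k pk; split; apply: horG.
Qed.

Lemma metric_TM_chart a p y i j : cdom a p ->
  metric_in_chart G a (row_mx (cmap a p) y) i j =
  bform (G (p, tvec a (cmap a p) y))
    (@tvec R (n + n) (TM M) a (row_mx (cmap a p) y) (delta_mx 0 i))
    (@tvec R (n + n) (TM M) a (row_mx (cmap a p) y) (delta_mx 0 j)).
Proof. by move=> ap; rewrite mxE /= row_mxKl row_mxKr (cparK atlasM ap). Qed.

Lemma metric_chart a p i j : cdom a p ->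
  metric_in_chart g a (cmap a p) i j =
  bform (g p) (tvec a (cmap a p) (delta_mx 0 i))
    (tvec a (cmap a p) (delta_mx 0 j)).
Proof. by move=> ap; rewrite mxE (cparK atlasM ap). Qed.

(** Tangent coordinates in the preferred chart are the identity, so smoothness of the chart matrix
    becomes regularity of [G] itself along a fibre. *)
Lemma metric_TM_chart_at p y :
  metric_in_chart G (chart_at p) (row_mx (cmap (chart_at p) p) y) = G (p, y).
Proof.
have cp := chart_atP atlasM p; set c := chart_at p in cp *.
have tid u : tvec c (cmap c p) u = u.
  by rewrite (tvecE atlasM _ cp) (derive_transition_id atlasM).
have TMid Z : @tvec R (n + n) (TM M) c (row_mx (cmap c p) y) Z = Z.
  rewrite -[Z]hsubmxK (tvec_TM atlasM _ _ _ cp) !tid.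
  by rewrite (derive2_transition_id atlasM) // add0r.
by apply/matrixP => i j; rewrite metric_TM_chart // !TMid tid bform_delta.
Qed.

Lemma metric_fiber_cvg p y (X X' : 'rV[R]_(n + n)) :
  bform (G (p, t *: y)) X X' @[t --> (0 : R)] --> bform (G (p, 0)) X X'.
Proof.
have Gcvg i j : G (p, t *: y) i j @[t --> (0 : R)] --> G (p, 0) i j.
  set c := chart_at p; have cp := chart_atP atlasM p.
  have -> : (fun t : R => G (p, t *: y) i j) =
      (fun z => metric_in_chart G c z i j) \o
      (fun t : R => row_mx (cmap c p) (t *: y)).
    by apply/funext => t; rewrite /= metric_TM_chart_at.
  (* Order 0 of [smooth_on] is continuity at the points of the chart image. *)
  have [_ _ /(_ c i j 0%N) smG] := metG.
  have zero : row_mx (cmap c p) (t *: y) @[t --> (0 : R)] -->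
      row_mx (cmap c p) (0 : 'rV[R]_n).
    apply: cvg_row_mx; first exact: cvg_cst.
    by rewrite -[X in _ --> X](scale0r y); apply: cvgZr_tmp; exact: cvg_id.
  have cont : {for row_mx (cmap c p) (0 : 'rV[R]_n),
      continuous (fun z => metric_in_chart G c z i j)}.
    (* The limit point lies in the chart image as the coordinates of the zero vector at p. *)
    apply: smG; exists (p, 0) => //=; congr row_mx.
    by rewrite /tcoord derive0.
  by rewrite -metric_TM_chart_at; exact: cvg_comp zero cont.
have inner j : \sum_i X 0 i * G (p, t *: y) i j @[t --> (0 : R)] -->
    \sum_i X 0 i * G (p, 0) i j.
  apply: cvg_big => [|i _]; first exact: add_continuous.
  exact: cvgM (cvg_cst _) (Gcvg i j).
rewrite bform_sum; under eq_fun do rewrite bform_sum.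
apply: cvg_big => [|j _]; first exact: add_continuous.
under eq_fun do rewrite -mulr_suml; rewrite -mulr_suml.
exact: cvgM (inner j) (cvg_cst _).
Qed.

Lemma tvec0 a p : cdom a p -> tvec a (cmap a p) 0 = 0.
Proof. by move=> ap; rewrite (tvecE atlasM _ ap) derive0. Qed.

Lemma tvecZ a p (t : R) y : cdom a p ->
  tvec a (cmap a p) (t *: y) = t *: tvec a (cmap a p) y.
Proof. by move=> ap; rewrite !(tvec_jacobian atlasM) // scalemxAl. Qed.

Lemma tvec_TM0 a p u w : cdom a p ->
  @tvec R (n + n) (TM M) a (row_mx (cmap a p) 0) (row_mx u w) =
  row_mx (tvec a (cmap a p) u) (tvec a (cmap a p) w).
Proof.
move=> ap; rewrite (tvec_TM atlasM _ _ _ ap).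
have -> : 'D_(0 : 'rV[R]_n) (transition a (chart_at p)) = cst 0.
  by apply/funext => x; rewrite derive0.
by rewrite derive_cst add0r.
Qed.

Lemma metric_split_row p y u w u' w' :
  bform (G (p, y)) (row_mx u w) (row_mx u' w') =
  bform (g p) u u' +
  bform (G (p, y)) (vert (w + Gamma g p u y)) (vert (w' + Gamma g p u' y)).
Proof. by rewrite metric_split /connection_map !row_mxKl !row_mxKr. Qed.

Lemma metric_split0 p u w u' w' :
  bform (G (p, 0)) (row_mx u w) (row_mx u' w') =
  bform (g p) u u' + bform (G (p, 0)) (vert w) (vert w').
Proof. by rewrite metric_split_row !Gamma0r !addr0. Qed.

Definition vertical_block a p : 'M[R]_n :=
  \matrix_(i, j) bform (G (p, 0)) (vert (tvec a (cmap a p) (delta_mx 0 i)))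
                                  (vert (tvec a (cmap a p) (delta_mx 0 j))).

(** At y = 0 both the Christoffel term and the second derivative of the transition vanish, so the
    coordinate vectors of the base are horizontal and those of the fibre vertical. *)
Lemma metric_TM_zero_section a p : cdom a p ->
  metric_in_chart G a (row_mx (cmap a p) 0) =
  block_mx (metric_in_chart g a (cmap a p)) 0 0 (vertical_block a p).
Proof.
move=> ap; apply/matrixP => i j.
rewrite (metric_TM_chart _ _ _ ap) (tvec0 ap).
case: (split_ordP i) => i' ->; case: (split_ordP j) => j' ->;
  rewrite ?delta_mx_lshift ?delta_mx_rshift !tvec_TM0 // (tvec0 ap);
  rewrite metric_split0.
- by rewrite block_mxEul metric_chart // row_mx0 (bform0l (G (p, 0))) addr0.
- by rewrite block_mxEur mxE row_mx0 (bform0l (G (p, 0))) addr0 bform0r.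
- by rewrite block_mxEdl mxE row_mx0 (bform0l (g p)) add0r bform0r.
- by rewrite block_mxEdr mxE (bform0l (g p)) add0r.
Qed.

Lemma metric_chart_unit a p : cdom a p ->
  metric_in_chart g a (cmap a p) \in unitmx.
Proof.
move=> ap; have [_ gpos _] := metg.
pose J := jacobian (transition a (chart_at p)) (cmap a p).
have -> : metric_in_chart g a (cmap a p) =
    \matrix_(i, j) bform (g p) (delta_mx 0 i *m J) (delta_mx 0 j *m J).
  by apply/matrixP => i j; rewrite metric_chart // mxE !(tvec_jacobian atlasM).
apply: gram_unitmx => [|v]; first exact: gpos.
by rewrite -(tvec_jacobian atlasM) //; exact: tvec_eq0.
Qed.

Lemma vertical_block_unit a p : cdom a p -> vertical_block a p \in unitmx.
Proof.
move=> ap; have [_ Gpos _] := metG.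
pose J := jacobian (transition a (chart_at p)) (cmap a p).
have -> : vertical_block a p = \matrix_(i, j)
    bform (G (p, 0)) (delta_mx 0 i *m row_mx 0 J) (delta_mx 0 j *m row_mx 0 J).
  apply/matrixP => i j; rewrite !mxE !(tvec_jacobian atlasM) //.
  by rewrite !mul_mx_row !mulmx0.
apply: gram_unitmx => [|v]; first exact: Gpos.
rewrite mul_mx_row mulmx0 -(tvec_jacobian atlasM) // -[RHS]row_mx0.
by move=> /eq_row_mx[_]; exact: tvec_eq0.
Qed.

(* The connection map of the k-th coordinate vector of TM in the chart a, at the
   point (cmap a p, y). *)
Definition vertical_part a p y (k : 'I_n) : 'rV[R]_n :=
  'D_(delta_mx 0 k) ('D_y (transition a (chart_at p))) (cmap a p)
  + Gamma g p (tvec a (cmap a p) (delta_mx 0 k)) (tvec a (cmap a p) y).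

Lemma vertical_partZ a p (t : R) y k : cdom a p ->
  vertical_part a p (t *: y) k = t *: vertical_part a p y k.
Proof.
move=> ap; rewrite /vertical_part.
rewrite (derive2_transitionZ atlasM _ _ _ ap (chart_atP atlasM p)).
by rewrite (tvecZ _ _ ap) GammaZr scalerDr.
Qed.

(** The projection of a base coordinate vector does not depend on y, so the splitting confines the
    dependence on y to the vertical term. *)
Lemma metric_TM_horizontal_block a p y i j : cdom a p ->
  metric_in_chart G a (row_mx (cmap a p) y) (lshift n i) (lshift n j) =
  metric_in_chart g a (cmap a p) i j +
  bform (G (p, tvec a (cmap a p) y))
    (vert (vertical_part a p y i)) (vert (vertical_part a p y j)).
Proof.
move=> ap; have liftE k :
    @tvec R (n + n) (TM M) a (row_mx (cmap a p) y) (delta_mx 0 (lshift n k)) =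
    row_mx (tvec a (cmap a p) (delta_mx 0 k))
      ('D_(delta_mx 0 k) ('D_y (transition a (chart_at p))) (cmap a p)).
  by rewrite delta_mx_lshift (tvec_TM atlasM _ _ _ ap) (tvec0 ap) addr0.
rewrite (metric_TM_chart _ _ _ ap) (metric_chart _ _ ap) -metric_split_row.
by congr bform; exact: liftE.
Qed.

(** Along the ray t y each vertical part carries a factor t, so the entry is a constant plus t^2
    times a quantity with a limit as t tends to 0. *)
Lemma partial_metric_TM_vertical a p m i j : cdom a p ->
  partial (rshift n m)
    (fun z => metric_in_chart G a z (lshift n i) (lshift n j))
    (row_mx (cmap a p) 0) = 0.
Proof.
move=> ap; set y : 'rV[R]_n := delta_mx 0 m.
(* What remains once t is taken out of both arguments: the vertical parts are frozen at y, while the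
   point at which [G] is evaluated still moves along the ray. *)
pose r t := bform (G (p, t *: tvec a (cmap a p) y))
  (vert (vertical_part a p y i)) (vert (vertical_part a p y j)).
apply: (@derive_quadratic _ _ _ _ _ (metric_in_chart g a (cmap a p) i j) r);
  last exact: metric_fiber_cvg.
move=> t; rewrite delta_mx_rshift scale_row_mx add_row_mx scaler0 add0r addr0.
rewrite (metric_TM_horizontal_block _ _ _ ap) (tvecZ _ _ ap).
congr (_ + _); rewrite /r -bform_row0Z.
exact: (f_equal2 (fun k k' => bform _ (vert k) (vert k'))
  (vertical_partZ t y i ap) (vertical_partZ t y j ap)).
Qed.

End NaturalMetric.

(** * Christoffel symbols and curvature on a totally geodesic slice *)

Section TotallyGeodesic.
Variables (R : realType) (n : nat).
Variables (h : 'rV[R]_n -> 'M[R]_n) (H : 'rV[R]_(n + n) -> 'M[R]_(n + n)).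
Implicit Types x : 'rV[R]_n.

(* The last condition says that the second fundamental form of R^n x 0 with
   respect to H vanishes at (x, 0). *)
Definition totally_geodesic_at x : Prop :=
  [/\ exists2 B, H (row_mx x 0) = block_mx (h x) 0 0 B & B \in unitmx,
      h x \in unitmx &
      forall m i j, partial (rshift n m)
        (fun z => H z (lshift n i) (lshift n j)) (row_mx x 0) = 0].

Variable D : set 'rV[R]_n.
Hypothesis openD : open D.
Hypothesis geodesicD : forall x, D x -> totally_geodesic_at x.

Let near_D x : D x -> \forall x' \near x, D x'.
Proof. by move=> Dx; apply: open_nbhs_nbhs; split. Qed.

(** The block form holds at all points of the open set [D], hence may be differentiated along the
    slice. *)
Lemma partial_tangential x i j k : D x ->
  partial (lshift n i) (fun z => H z (lshift n j) (lshift n k)) (row_mx x 0) =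
  partial i (fun x => h x j k) x.
Proof.
move=> Dx; have nDx := near_D Dx; rewrite partial_lshift; apply: near_eq_derive.
near=> x'; have [[B -> _] _ _] : totally_geodesic_at x'.
  by apply: geodesicD; near: x'.
exact: block_mxEul.
Unshelve. all: by end_near. Qed.

Lemma partial_mixed x i j k : D x ->
  partial (lshift n i) (fun z => H z (lshift n j) (rshift n k)) (row_mx x 0) =
  0.
Proof.
move=> Dx; have nDx := near_D Dx; rewrite partial_lshift.
rewrite -[RHS](@derive_cst R _ _ (0 : R) x (delta_mx 0 i)).
apply: near_eq_derive.
near=> x'; have [[B -> _] _ _] : totally_geodesic_at x'.
  by apply: geodesicD; near: x'.
by rewrite block_mxEur mxE.
Unshelve. all: by end_near. Qed.

(** The tangential block of the inverse of [H] is the inverse of [h x]. A summand with normal index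
    involves only slice derivatives of mixed entries and a normal derivative of a tangential entry,
    all zero. *)
Lemma christoffel_tangential x l j k : D x ->
  christoffel H (row_mx x 0) (lshift n l) (lshift n j) (lshift n k) =
  christoffel h x l j k.
Proof.
move=> Dx; have [[B HB uB] uh vert0] := geodesicD Dx.
rewrite /christoffel; congr (_ * _); rewrite big_split_ord /= addrC big1 ?add0r.
  rewrite HB invmx_block_diag ?block_diag_mx_unit ?uh //.
  apply: eq_bigr => m _; rewrite block_mxEul; congr (_ * _).
  by rewrite !partial_tangential.
move=> m _.
by rewrite !partial_mixed // vert0 subr0 addr0 mulr0.
Qed.

(** In each summand either the off-diagonal block of the inverse or the bracket of derivatives is
    zero. *)
Lemma christoffel_normal x l j k : D x ->
  christoffel H (row_mx x 0) (rshift n l) (lshift n j) (lshift n k) = 0.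
Proof.
move=> Dx; have [[B HB uB] uh vert0] := geodesicD Dx.
rewrite /christoffel big_split_ord /= !big1 ?addr0 ?mulr0 // => m _.
  by rewrite !partial_mixed // vert0 subr0 addr0 mulr0.
rewrite HB invmx_block_diag ?block_diag_mx_unit ?uh //.
by rewrite block_mxEdl mxE mul0r.
Qed.

(** This is the Gauss equation with zero second fundamental form: the derivatives run along the
    slice, and for normal m the second factor of each product is a vanishing normal Christoffel
    symbol. *)
Lemma curvature_coef_tangential x l k i j : D x ->
  curvature_coef (christoffel H) (row_mx x 0)
    (lshift n l) (lshift n k) (lshift n i) (lshift n j) =
  curvature_coef (christoffel h) x l k i j.
Proof.
move=> Dx; have dE i' j' : partial (lshift n i')
    (fun z => christoffel H z (lshift n l) (lshift n j') (lshift n k))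
    (row_mx x 0) = partial i' (fun y => christoffel h y l j' k) x.
  rewrite partial_lshift; apply: near_eq_derive.
  have nDx := near_D Dx; near=> x'.
  by apply: christoffel_tangential; near: x'.
rewrite /curvature_coef !dE; congr (_ + _).
rewrite big_split_ord /= [X in _ + X]big1 ?addr0 => [|m _]; last first.
  by rewrite !(christoffel_normal m) // !mulr0 subrr.
by apply: eq_bigr => m _; rewrite !christoffel_tangential.
Unshelve. all: by end_near. Qed.

End TotallyGeodesic.

(** * Passage of flatness from [TM M] to [M] along the zero section *)

Theorem corollary4p1 (R : realType) (n : nat) (M : charted_space R n)
    (g : M -> 'M[R]_n) (G : TM M -> 'M[R]_(n + n)) :
  (2 <= n)%N -> smooth_manifold M -> riemannian_metric g ->
  natural_metric g G -> flat G -> flat g.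
Proof.
move=> _ [atlasM _ _] metg [metG subG horG _] flatG p X Y Z.
set c := chart_at p; have cp : cdom c p := chart_atP atlasM p.
(* The whole image of the chart, written as the overlap of [c] with itself so that its openness is
   an instance of the atlas axiom. *)
pose D := cmap c @` (cdom c `&` cdom c).
have geodesicD x : D x ->
    totally_geodesic_at (metric_in_chart g c) (metric_in_chart G c) x.
  move=> [q [cq _] <-]; split.
  - exists (vertical_block G c q); first exact: metric_TM_zero_section.
    exact: vertical_block_unit.
  - exact: metric_chart_unit.
  - by move=> m i j; exact: (partial_metric_TM_vertical atlasM metG subG horG).
suff coef0 l k i j :
    curvature_coef (christoffel (metric_in_chart g c)) (cmap c p) l k i j = 0.
  apply/rowP => l; rewrite !mxE; apply: big1 => i _; apply: big1 => j _.
  by apply: big1 => k _; rewrite coef0 mulr0.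
have openD : open D by case: atlasM => _ _ + _; apply.
have Dp : D (cmap c p) by exists p.
rewrite -(curvature_coef_tangential openD geodesicD _ _ _ _ Dp).
(* Flatness of [G] is used at the zero vector over p, on coordinate vectors tangent to the zero
   section. *)
have := curvature_delta G (p, 0) (lshift n i) (lshift n j) (lshift n k)
  (lshift n l).
rewrite flatG mxE => /esym; rewrite /= -/c.
(* The fibre coordinate of the zero vector is a derivative in direction 0, so its chart point is
   [row_mx (cmap c p) 0]. *)
by rewrite /tcoord derive0.
Qed.
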